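(* Let $\hat\theta^{\mathcal T}\in\arg\min_{\theta\in\Theta}\min_{M\in\mathcal M}\widehat{\mathcal R}^{\mathcal T}_{\theta,M}$ be obtained using only the target data set $\mathcal D^{\mathcal T}$ of $N^{\mathcal T}$ i.i.d. samples from $p^{\mathcal T}(c,x)$. For every $\delta\in(0,1)$, with probability at least $1-\delta$ over the draw of $\mathcal D^{\mathcal T}$, $$\mathcal R^{\mathcal T}_{\hat\theta^{\mathcal T},\widehat M^{\mathcal T}_{\hat\theta^{\mathcal T}}}-\mathcal R^{\mathcal T}_{\hat\theta^{\mathcal T}}\le\frac{2(\mathfrak R^{\mathcal T}_{\Theta,\mathcal M}+\mathfrak R^{\mathcal T}_{\mathcal M})}{\sqrt{N^{\mathcal T}}}+\sqrt{\frac{2}{N^{\mathcal T}}\log\frac2\delta},$$ where moreover $\mathfrak R^{\mathcal T}_{\mathcal M}\le\tfrac12\sqrt{\sup_{\theta\in\Theta}2^{I^{\mathcal T}_2(X;R_\theta)}}$.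
   Context: $\mathcal X$ finite, labels $c\in\{0,1\}$, $\Theta$ arbitrary, $\rho_\theta(x)$ density matrices on $\mathbb C^n$, $\mathcal M$ the binary POVMs $M=(M_0,M_1)$, $M_c\succeq0$, $M_0+M_1=I$; loss $\ell_{\theta,M}(c,x)=1-\mathrm{Tr}(M_c\rho_\theta(x))$. For task $\mathcal A\in\{\mathcal S,\mathcal T\}$ with distribution $p^{\mathcal A}(c,x)$ and data set $\mathcal D^{\mathcal A}$ of $N^{\mathcal A}$ i.i.d. samples: expected risk $\mathcal R^{\mathcal A}_{\theta,M}=\mathbb E_{p^{\mathcal A}}[\ell_{\theta,M}]$, $\mathcal R^{\mathcal A}_\theta=\min_M\mathcal R^{\mathcal A}_{\theta,M}$, empirical risk $\widehat{\mathcal R}^{\mathcal A}_{\theta,M}=\frac1{N^{\mathcal A}}\sum_{(c,x)\in\mathcal D^{\mathcal A}}\ell_{\theta,M}(c,x)$, and $\widehat M^{\mathcal A}_\theta\in\arg\min_{M\in\mathcal M}\widehat{\mathcal R}^{\mathcal A}_{\theta,M}$ (minimizers assumed to exist). Rademacher complexities (with $(c_j,x_j)$ i.i.d. from $p^{\mathcal A}$ and independent uniform signs $\sigma_j\in\{\pm1\}$): $\mathfrak R^{\mathcal A}_{\mathcal M}=\sup_{\theta}\mathbb E[\sup_{M}\sum_{j=1}^{N^{\mathcal A}}\sigma_j\ell_{\theta,M}(c_j,x_j)/\sqrt{N^{\mathcal A}}]$ and $\mathfrak R^{\mathcal A}_{\Theta,\mathcal M}=\mathbb E[\sup_{\theta,M}\sum_{j=1}^{N^{\mathcal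 A}}\sigma_j\ell_{\theta,M}(c_j,x_j)/\sqrt{N^{\mathcal A}}]$. The 2-Rényi mutual information is $I^{\mathcal A}_2(X;R_\theta)=2\log_2\mathrm{Tr}\bigl(\sqrt{\sum_x p^{\mathcal A}(x)\rho_\theta(x)^2}\bigr)$, where $p^{\mathcal A}(x)$ is the input marginal. *)

(* Defs.v *)
From HB Require Import structures.
From mathcomp Require Import all_boot all_order all_algebra.
From mathcomp Require Import all_classical all_reals all_analysis.
From mathcomp Require Import complex.

Unset Strict Implicit.
Unset Printing Implicit Defensive.

Import Order.TTheory GRing.Theory Num.Theory.
Local Open Scope ring_scope.
Local Open Scope classical_set_scope.

Definition adjm {R : realType} {m p : nat} (A : 'M[R[i]]_(m, p)) : 'M[R[i]]_(p, m) :=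
  map_mx (@conjc R) A^T.

Definition psd {R : realType} {n : nat} (A : 'M[R[i]]_n) : Prop :=
  adjm A = A /\ forall v : 'cV[R[i]]_n, 0 <= (adjm v *m A *m v) 0 0.

Definition density {R : realType} {n : nat} (rho : 'M[R[i]]_n) : Prop :=
  psd rho /\ \tr rho = 1.

(* binary POVM, label c : bool (false = 0, true = 1) *)
Definition povm {R : realType} {n : nat} (M : bool -> 'M[R[i]]_n) : Prop :=
  psd (M false) /\ psd (M true) /\ M false + M true = 1%:M.

(* loss l_{theta,M}(c,x) = 1 - Tr(M_c rho_theta(x)) (real part; the trace is real) *)
Definition loss {R : realType} {n : nat} {X : Type} (rho : X -> 'M[R[i]]_n)
  (M : bool -> 'M[R[i]]_n) (c : bool) (x : X) : R :=
  1 - @complex.Re R (\tr (M c *m rho x)).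

Definition exp_risk {R : realType} {n : nat} {X : finType} (p : bool * X -> R)
  (rho : X -> 'M[R[i]]_n) (M : bool -> 'M[R[i]]_n) : R :=
  \sum_(cx : bool * X) p cx * loss rho M cx.1 cx.2.

(* R_theta = min_M R_{theta,M} (written as an infimum over POVMs) *)
Definition opt_risk {R : realType} {n : nat} {X : finType} (p : bool * X -> R)
  (rho : X -> 'M[R[i]]_n) : R :=
  inf [set r : R | exists M, povm M /\ r = exp_risk p rho M].

Definition dataset (X : finType) (N : nat) := {ffun 'I_N -> bool * X}.

Definition emp_risk {R : realType} {n : nat} {X : finType} {N : nat}
  (rho : X -> 'M[R[i]]_n) (M : bool -> 'M[R[i]]_n) (D : dataset X N) : R :=
  (N%:R)^-1 * \sum_(j < N) loss rho M (D j).1 (D j).2.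

Definition ds_prob {R : realType} {X : finType} {N : nat} (p : bool * X -> R)
  (D : dataset X N) : R := \prod_(j < N) p (D j).

Definition ds_Pr {R : realType} {X : finType} (N : nat) (p : bool * X -> R)
  (E : dataset X N -> bool) : R :=
  \sum_(D : dataset X N | E D) ds_prob p D.

Definition sgn {R : realType} (b : bool) : R := if b then 1 else -1.

Definition rad_E {R : realType} {X : finType} (N : nat) (p : bool * X -> R)
  (F : dataset X N -> {ffun 'I_N -> bool} -> R) : R :=
  \sum_(D : dataset X N) \sum_(s : {ffun 'I_N -> bool})
     ds_prob p D * (2 ^- N) * F D s.

Definition rad_sum {R : realType} {n : nat} {X : finType} {N : nat}
  (rho : X -> 'M[R[i]]_n) (M : bool -> 'M[R[i]]_n)
  (D : dataset X N) (s : {ffun 'I_N -> bool}) : R :=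
  (\sum_(j < N) sgn (s j) * loss rho M (D j).1 (D j).2) / Num.sqrt (N%:R).

Definition rad_M {R : realType} {n : nat} {X : finType} {Theta : Type} (N : nat)
  (p : bool * X -> R) (rho : Theta -> X -> 'M[R[i]]_n) : R :=
  sup [set r : R | exists th : Theta, r =
    rad_E N p (fun D s => sup [set v : R | exists M, povm M /\ v = rad_sum (rho th) M D s])].

Definition rad_ThM {R : realType} {n : nat} {X : finType} {Theta : Type} (N : nat)
  (p : bool * X -> R) (rho : Theta -> X -> 'M[R[i]]_n) : R :=
  rad_E N p (fun D s =>
    sup [set v : R | exists (th : Theta) M, povm M /\ v = rad_sum (rho th) M D s]).

(* trace of the (PSD) matrix square root of A (unique when A is PSD) *)
Definition tr_msqrt {R : realType} {n : nat} (A : 'M[R[i]]_n) : R :=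
  @complex.Re R (\tr (xget 0 [set S : 'M[R[i]]_n | psd S /\ S *m S = A])).

Definition marg {R : realType} {X : finType} (p : bool * X -> R) (x : X) : R :=
  p (false, x) + p (true, x).

Definition renyi2_MI {R : realType} {n : nat} {X : finType} (p : bool * X -> R)
  (rho : X -> 'M[R[i]]_n) : R :=
  2 * (ln (tr_msqrt (\sum_(x : X) Complex (marg p x) 0 *: (rho x *m rho x))) / ln 2).

(* Main.v *)
Require Import Defs.
From HB Require Import structures.
From mathcomp Require Import all_boot all_order all_algebra.
From mathcomp Require Import all_classical all_reals all_analysis.
From mathcomp Require Import complex ring lra.
Import Order.TTheory GRing.Theory Num.Theory.
Import numFieldNormedType.Exports.
Local Open Scope ring_scope.
Local Open Scope classical_set_scope.

(** Write [Rhat_min(D)] for the minimal empirical risk.  It equals the empirical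
    risk at the minimizer, and its mean is at most every expected risk, hence at
    most [R_theta] for every [theta].  Therefore the excess risk is at most
    [F(D) - E Rhat_min] with
    [F(D) = sup_(theta, M) (R - Rhat(D)) + Rhat_min(D)].  [F] changes by at most
    [2/N] when one sample changes, so McDiarmid's inequality bounds [F - E F] by
    the square-root term, and symmetrization bounds the mean of the supremum by
    twice the Rademacher complexity of the full class.

    For the second inequality, the loss is [1/2 -/+ Tr(A rho)/2] with
    [A = M_0 - M_1] and [A^2 <= 1], and for positive definite [B]
    [2 Tr(A S) <= Tr(A B A) + Tr(B^-1 S^2) <= Tr B + Tr(B^-1 S^2)].  Averaging
    over the signed sum [S] of states with [B] tending to the square root of
    [E S^2 = sum_x p(x) rho(x)^2] gives the trace of that root. *)

Set Implicit Arguments.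
Unset Strict Implicit.

(** * Hoeffding's lemma for finitely supported distributions *)

Lemma inhabited_sum1 (R : realType) (T : finType) (p : T -> R) :
  \sum_x p x = 1 -> inhabited T.
Proof.
have [x0 _|T0] := pickP (mem T); first by exists.
by rewrite big_pred0// => /esym/eqP; rewrite oner_eq0.
Qed.

(** By the mean value theorem, [f x = df c * x] for some [c] in [[0, x]]. Applying this twice
    integrates a sign condition on a second derivative. *)
Lemma ge0_is_derive_ge0 (R : realType) (f df : R -> R) :
  (forall x : R, is_derive x 1 f (df x)) -> f 0 = 0 ->
  (forall x, 0 <= x -> 0 <= df x) -> forall x, 0 <= x -> 0 <= f x.
Proof.
move=> fdf f0 df0 x x0.
have cf : {within `[0, x], continuous f}.
  by apply: derivable_within_continuous => z _; exact: @ex_derive.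
have [c cx fx] := MVT_segment x0 (fun z _ => fdf z) cf.
rewrite f0 !subr0 in fx; rewrite fx mulr_ge0 // df0 //.
by rewrite (itvP cx).
Qed.

Lemma expR_le_chord (R : realType) (h w : R) : 0 <= w <= 1 ->
  expR (h * w) <= 1 - w + w * expR h.
Proof.
move=> /andP[w0 w1].
have := @convex_expR R (Itv01 w0 w1) h 0.
rewrite !convRE /= expR0.
by rewrite mulr0 addr0 mulr1 addrC (mulrC h).
Qed.

(** The logarithmic gap [g] vanishes at [0] together with its derivative [g1], and its second
    derivative is [1/4 - q (1 - q) >= 0] with [q = p e^x / u x]. *)
Lemma bernoulli_mgf_le (R : realType) (p h : R) : 0 <= p <= 1 -> 0 <= h ->
  1 - p + p * expR h <= expR (p * h + h ^+ 2 / 8).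
Proof.
move=> /andP[p0 p1] h0.
pose u (x : R) : R := 1 - p + p * expR x.
have u_gt0 x : 0 < u x.
  rewrite /u; have := expR_gt0 x; case: (eqVneq p 0) => [-> _|pN0 e0]; first lra.
  by rewrite ltr_wpDl ?subr_ge0// mulr_gt0// lt_def pN0.
have uN0 x : u x != 0 by rewrite gt_eqF.
have du (x : R) : is_derive x 1 u (p * expR x).
  have -> : p * expR x = 0 + (p *: expR x) by rewrite add0r.
  exact: is_deriveD.
(* This is [p + x / 4 - p e^x / u x], rewritten through [p e^x = u x - (1 - p)]. *)
pose g1 (x : R) : R := p - 1 + 4^-1 * x + (1 - p) * (u x)^-1.
have dg1 (x : R) :
    is_derive x 1 g1 (4^-1 - (1 - p) * (p * expR x) / u x ^+ 2).
  have := is_deriveD (is_deriveD (is_derive_cst (p - 1) x 1)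
    (is_deriveZ 4^-1 (is_derive_id x 1)))
    (is_deriveZ (1 - p) (is_deriveV (uN0 x) (du x))).
  move=> /is_derive_eq; apply.
  by rewrite /GRing.scale /=; field.
have g1_ge0 : forall x, 0 <= x -> 0 <= g1 x.
  apply: (ge0_is_derive_ge0 dg1) => [|x _].
    by rewrite /g1 /u expR0 mulr1 subrK invr1; ring.
  rewrite subr_ge0 ler_pdivrMr ?exprn_gt0// /u.
  (* This square equals [u x ^ 2 - 4 (1 - p) p e^x]. *)
  have := sqr_ge0 (1 - p - p * expR x); rewrite !expr2; lra.
pose g (x : R) : R := p * x + 8^-1 * x ^+ 2 - ln (u x).
have dg (x : R) : is_derive x 1 g (g1 x).
  have := is_deriveB (is_deriveD (is_deriveZ p (is_derive_id x 1))
    (is_deriveZ 8^-1 (is_deriveX 2 (is_derive_id x 1))))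
    (is_derive1_comp (is_derive1_ln (u_gt0 x)) (du x)).
  move=> /is_derive_eq; apply.
  have -> : p * expR x = u x - (1 - p) by rewrite /u; ring.
  by rewrite /g1 /GRing.scale /=; field.
have : 0 <= g h.
  apply: (ge0_is_derive_ge0 dg) => //.
  by rewrite /g /u expR0 mulr1 subrK ln1 mulr0 expr0n mulr0 !addr0 subrr.
rewrite /g subr_ge0 mulrC (mulrC _^-1) => ulh.
by rewrite -[leLHS]lnK ?posrE ?u_gt0// ler_expR.
Qed.

(** On an interval of length [c] containing the values of [Z], the exponential lies below its chord.
    The chord is affine in [Z], so its mean is that of a two-point variable, to which the Bernoulli
    bound applies. *)
Lemma hoeffding_mgf (R : realType) (T : finType) (p : T -> R) (Z : T -> R)
    (c l : R) :
  (forall x, 0 <= p x) -> \sum_x p x = 1 -> 0 < c -> 0 <= l ->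
  (forall x y, Z x <= Z y + c) ->
  \sum_x p x * expR (l * Z x)
    <= expR (l * \sum_x p x * Z x + (l * c) ^+ 2 / 8).
Proof.
move=> p0 p1 c0 l0 Zc.
have [x0] := inhabited_sum1 p1.
have [a] : exists a, forall x, a <= Z x <= a + c.
  have [i _ iZ] := @arg_minP _ R T x0 xpredT Z isT.
  by exists (Z i) => x; rewrite iZ//= Zc.
move=> aZ.
(* The relative position of the mean of [Z] in [[a, a + c]] is the Bernoulli parameter. *)
pose q := (\sum_x p x * Z x - a) / c.
have qE : \sum_x p x * Z x = a + q * c by rewrite /q divfK ?gt_eqF//; ring.
have E0 : \sum_x p x * a <= \sum_x p x * Z x <= \sum_x p x * (a + c).
  by apply/andP; split; apply: ler_sum => x _; apply: ler_wpM2l => //;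
    have /andP[] := aZ x.
rewrite -!mulr_suml p1 !mul1r qE in E0.
have q01 : 0 <= q <= 1.
  rewrite -(ler_pM2r c0) -[X in _ && X](ler_pM2r c0) mul0r mul1r; lra.
have -> : expR (l * \sum_x p x * Z x + (l * c) ^+ 2 / 8)
   = expR (l * a) * expR (q * (l * c) + (l * c) ^+ 2 / 8).
  by rewrite -expRD qE; congr expR; ring.
apply: le_trans (ler_wpM2l (expR_ge0 _) (bernoulli_mgf_le q01 _)); last first.
  by rewrite mulr_ge0// ltW.
have -> : expR (l * a) * (1 - q + q * expR (l * c)) =
   \sum_x p x * (expR (l * a) *
     (1 - (Z x - a) / c + (Z x - a) / c * expR (l * c))).
  transitivity (\sum_x (p x * (expR (l * a) * (1 + a / c - a / c * expR (l * c)))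
     + (p x * Z x) * (expR (l * a) * (expR (l * c) - 1) / c))).
    rewrite big_split /= -!mulr_suml p1 qE; field; lra.
  by apply: eq_bigr => x _; field; lra.
apply: ler_sum => x _; apply: ler_wpM2l => //.
have -> : l * Z x = l * a + (l * c) * ((Z x - a) / c) by field; lra.
rewrite expRD; apply: ler_wpM2l; first exact: expR_ge0.
apply: expR_le_chord.
rewrite ler_pdivlMr// ler_pdivrMr// mul0r mul1r; have := aZ x; lra.
Qed.

(** A real [sup] takes a default value on sets that are empty or unbounded above. The bound [c] and
    the index [i] exclude this, here and in the next lemma. *)
Lemma le_sup_range (R : realType) (I : Type) (f : I -> R) (c : R) (i : I) :
  (forall j, f j <= c) -> f i <= sup (range f).
Proof. by move=> fc; apply: ub_le_sup; [exists c => _ [j _ <-]|exists i]. Qed.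

Lemma sup_range_le (R : realType) (I : Type) (f : I -> R) (c : R) (i : I) :
  (forall j, f j <= c) -> sup (range f) <= c.
Proof. by move=> fc; apply: ge_sup; [exists (f i), i|move=> _ [j _ <-]]. Qed.

(** * Expectations over i.i.d. samples from a finite type *)

Definition iid_E {R : realType} {T : finType} {N : nat} (p : T -> R)
  (F : {ffun 'I_N -> T} -> R) : R :=
  \sum_(D : {ffun 'I_N -> T}) (\prod_(j < N) p (D j)) * F D.

(** Splits off the first sample, so that product expectations can be treated by induction on the
    sample size. *)
Definition ffun_cons {T : finType} {N : nat} (x : T) (D : {ffun 'I_N -> T}) :
  {ffun 'I_N.+1 -> T} := [ffun i => oapp D x (unlift ord0 i)].

Lemma ffun_cons0 (T : finType) (N : nat) (x : T) (D : {ffun 'I_N -> T}) :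
  ffun_cons x D ord0 = x.
Proof. by rewrite ffunE unlift_none. Qed.

Lemma ffun_consS (T : finType) (N : nat) (x : T) (D : {ffun 'I_N -> T}) j :
  ffun_cons x D (lift ord0 j) = D j.
Proof. by rewrite ffunE liftK. Qed.

Lemma sum_ffun_recl (R : realType) (T : finType) (N : nat)
    (G : {ffun 'I_N.+1 -> T} -> R) :
  \sum_D G D = \sum_x \sum_D G (ffun_cons x D).
Proof.
rewrite pair_big /=.
rewrite (reindex (fun xD : T * {ffun 'I_N -> T} => ffun_cons xD.1 xD.2)) //=.
exists (fun D => (D ord0, [ffun j => D (lift ord0 j)])) => [[x D] _|D _] /=.
  rewrite ffun_cons0; congr pair; apply/ffunP => j.
  by rewrite ffunE ffun_consS.
by apply/ffunP => j; rewrite ffunE; case: unliftP => [k|] ->//=; rewrite ffunE.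
Qed.

Lemma iid_E_recl (R : realType) (T : finType) (N : nat) (p : T -> R)
    (F : {ffun 'I_N.+1 -> T} -> R) :
  iid_E p F = \sum_x p x * iid_E p (fun D => F (ffun_cons x D)).
Proof.
rewrite /iid_E sum_ffun_recl; apply: eq_bigr => x _.
rewrite mulr_sumr; apply: eq_bigr => D _.
rewrite big_ord_recl ffun_cons0 mulrA; congr (_ * _ * _).
by apply: eq_bigr => j _; rewrite ffun_consS.
Qed.

Lemma iid_ED (R : realType) (T : finType) (N : nat) (p : T -> R)
    (F G : {ffun 'I_N -> T} -> R) :
  iid_E p (fun D => F D + G D) = iid_E p F + iid_E p G.
Proof. by rewrite -big_split; apply: eq_bigr => D _; rewrite mulrDr. Qed.

Lemma iid_EZ (R : realType) (T : finType) (N : nat) (p : T -> R) (c : R)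
    (F : {ffun 'I_N -> T} -> R) :
  iid_E p (fun D => c * F D) = c * iid_E p F.
Proof. by rewrite mulr_sumr; apply: eq_bigr => D _; rewrite mulrCA. Qed.

Lemma iid_E_sum (R : realType) (T J : finType) (N : nat) (p : T -> R)
    (F : J -> {ffun 'I_N -> T} -> R) :
  iid_E p (fun D => \sum_j F j D) = \sum_j iid_E p (F j).
Proof. by rewrite exchange_big; apply: eq_bigr => D _; rewrite mulr_sumr. Qed.

Lemma iid_E_le (R : realType) (T : finType) (N : nat) (p : T -> R)
    (F G : {ffun 'I_N -> T} -> R) : (forall x, 0 <= p x) ->
  (forall D, F D <= G D) -> iid_E p F <= iid_E p G.
Proof.
move=> p0 FG; apply: ler_sum => D _; apply: ler_wpM2l => //.
exact: prodr_ge0.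
Qed.

Lemma iid_E_coord (R : realType) (T : finType) (N : nat) (p : T -> R)
    (f : T -> R) (k : 'I_N) : \sum_x p x = 1 ->
  iid_E p (fun D => f (D k)) = \sum_x p x * f x.
Proof.
(* Placing [f] at coordinate [k] only makes the expectation a product of one-coordinate sums, all
   equal to [1] except the [k]-th. *)
move=> p1; pose h i x := p x * (if i == k then f x else 1).
transitivity (\prod_(i < N) \sum_x h i x).
  rewrite bigA_distr_bigA; apply: eq_bigr => D _ /=.
  rewrite big_split /=; congr (_ * _).
  by rewrite (bigD1 k)//= eqxx big1 ?mulr1// => i /negbTE ->.
rewrite (bigD1 k)//= /h eqxx [X in _ * X]big1 ?mulr1// => i /negbTE ->.
by under eq_bigr do rewrite mulr1.
Qed.

Lemma iid_E_cst (R : realType) (T : finType) (N : nat) (p : T -> R) (c : R) :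
  \sum_x p x = 1 -> iid_E p (fun _ : {ffun 'I_N -> T} => c) = c.
Proof.
move=> p1; rewrite /iid_E -mulr_suml.
rewrite -(bigA_distr_bigA (fun (_ : 'I_N) => p)) /=.
by rewrite big1 ?mul1r// => i _.
Qed.

Lemma iid_E_mean (R : realType) (T : finType) (N : nat) (p : T -> R)
    (f : T -> R) : \sum_x p x = 1 -> (0 < N)%N ->
  iid_E p (fun D : {ffun 'I_N -> T} => N%:R^-1 * \sum_(j < N) f (D j))
    = \sum_x p x * f x.
Proof.
move=> p1 N0; rewrite iid_EZ iid_E_sum.
under eq_bigr do rewrite iid_E_coord//.
by rewrite sumr_const card_ord -[X in _ * X]mulr_natl mulKf// pnatr_eq0 -lt0n.
Qed.

(** * McDiarmid's inequality *)

(** One-sided, but exchanging [D] and [D'] gives the bound on the absolute difference. *)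
Definition bounded_diff {R : realType} {T : finType} {N : nat} (c : R)
    (F : {ffun 'I_N -> T} -> R) : Prop :=
  forall (D D' : {ffun 'I_N -> T}) (k : 'I_N), (forall j, j != k -> D j = D' j) -> F D <= F D' + c.

(** Induction on the sample size in place of a martingale: the induction hypothesis handles the
    remaining samples with the first one fixed, then Hoeffding's lemma handles the conditional mean
    [F1]. *)
Lemma mcdiarmid_mgf (R : realType) (T : finType) (N : nat) (p : T -> R)
    (F : {ffun 'I_N -> T} -> R) (c l : R) :
  (forall x, 0 <= p x) -> \sum_x p x = 1 -> 0 < c -> 0 <= l ->
  bounded_diff c F ->
  iid_E p (fun D => expR (l * F D))
    <= expR (l * iid_E p F + N%:R * ((l * c) ^+ 2 / 8)).
Proof.
move=> p0 p1 c0 l0.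
elim: N F => [|N IH] F Fc.
  have [x0] := inhabited_sum1 p1.
  have FE : F = fun=> F [ffun=> x0].
    by apply/funext => D; congr F; apply/ffunP => -[].
  by rewrite FE !iid_E_cst// mul0r addr0.
rewrite !iid_E_recl; set F1 := fun x => iid_E p (fun D => F (ffun_cons x D)).
have F1c x y : F1 x <= F1 y + c.
  rewrite /F1 -(iid_E_cst N c p1) -iid_ED; apply: iid_E_le => // D.
  apply: (Fc _ _ ord0) => j; case: (unliftP ord0 j) => [k|] ->; last first.
    by rewrite eqxx.
  by rewrite !ffun_consS.
apply: (@le_trans _ _ (\sum_x p x *
    expR (l * F1 x + N%:R * ((l * c) ^+ 2 / 8)))).
  apply: ler_sum => x _; apply: ler_wpM2l => //; apply: IH => D D' k DD'.
  apply: (Fc _ _ (lift ord0 k)) => j.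
  case: (unliftP ord0 j) => [i|] -> ij; last by rewrite !ffun_cons0.
  by rewrite !ffun_consS DD'//; apply: contraNN ij => /eqP ->.
under eq_bigr do rewrite expRD mulrA.
rewrite -mulr_suml -[N.+1%:R]natr1 mulrDl mul1r addrCA addrC expRD.
rewrite mulrC [leRHS]mulrC; apply: ler_wpM2l; first exact: expR_ge0.
exact: hoeffding_mgf.
Qed.

(** Chernoff's method: Markov's inequality for [expR (l * F D)] on the complementary event. *)
Lemma mcdiarmid (R : realType) (T : finType) (N : nat) (p : T -> R)
    (F : {ffun 'I_N -> T} -> R) (c t : R) :
  (forall x, 0 <= p x) -> \sum_x p x = 1 -> 0 < c -> 0 <= t -> (0 < N)%N ->
  bounded_diff c F ->
  1 - expR (- (2 * t ^+ 2 / (N%:R * c ^+ 2)))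
    <= \sum_(D : {ffun 'I_N -> T} | F D <= iid_E p F + t) \prod_(j < N) p (D j).
Proof.
move=> p0 p1 c0 t0 N0 Fc.
have N0' : (0 : R) < N%:R by rewrite ltr0n.
(* The minimizer of [- l t + N (l c)^2 / 8]. *)
pose l := 4 * t / (N%:R * c ^+ 2).
have l0 : 0 <= l by rewrite divr_ge0// ?mulr_ge0// ?exprn_ge0// ltW.
have := mcdiarmid_mgf p0 p1 c0 l0 Fc.
set m := iid_E p F => mgf.
have lE : l * m + N%:R * ((l * c) ^+ 2 / 8) =
    - (2 * t ^+ 2 / (N%:R * c ^+ 2)) + l * (m + t).
  by rewrite /l; field; rewrite !gt_eqF.
rewrite lE expRD in mgf.
have := iid_E_cst N (1 : R) p1; rewrite /iid_E -mulr_suml mulr1 => /esym sum1.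
rewrite lerBlDr [leLHS]sum1 [leLHS](bigID (fun D => F D <= m + t)) /= lerD2l.
rewrite -(ler_pM2r (expR_gt0 (l * (m + t)))).
apply: le_trans mgf; rewrite /iid_E.
rewrite [leRHS](bigID (fun D => F D <= m + t)) /= ler_wpDl//.
  by apply: sumr_ge0 => D _; rewrite mulr_ge0 ?expR_ge0// prodr_ge0.
rewrite mulr_suml; apply: ler_sum => D; rewrite -ltNge => mF.
apply: ler_wpM2l; first exact: prodr_ge0.
by rewrite ler_expR ler_wpM2l// ltW.
Qed.

(** * Rademacher averages and symmetrization *)

(** The index type is arbitrary, so that measurements alone and pairs of a parameter and a
    measurement are both covered. *)
Definition rademacher {R : realType} {T : finType} {I : Type} (N : nat)
    (p : T -> R) (g : I -> T -> R) : R :=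
  iid_E p (fun D : {ffun 'I_N -> T} => 2 ^- N * \sum_(s : {ffun 'I_N -> bool})
    sup (range (fun i : I =>
      (\sum_(j < N) sgn (s j) * g i (D j)) / Num.sqrt N%:R))).

Lemma sgnN (R : realType) (b : bool) : sgn (~~ b) = - sgn b :> R.
Proof. by case: b; rewrite /sgn /= ?opprK. Qed.

Lemma normr_sgn (R : realType) (b : bool) : `|sgn b : R| = 1.
Proof. by case: b; rewrite /sgn /= ?normrN normr1. Qed.

(** Flipping the [k]-th sign is an involution of the sign vectors, so the sum equals its own
    opposite. *)
Lemma sum_signs_odd (R : realType) (N : nat) (k : 'I_N)
    (G : {ffun 'I_N -> bool} -> R) :
  (forall s : {ffun 'I_N -> bool}, G [ffun j => (j == k) (+) s j] = - G s) -> \sum_s G s = 0.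
Proof.
move=> Gk; apply/eqP; rewrite -[_ == 0](eqr_pMn2r (n := 2))// mul0rn mulr2n.
pose fl (s : {ffun 'I_N -> bool}) : {ffun 'I_N -> bool} :=
  [ffun j => (j == k) (+) s j].
have flK : involutive fl by move=> s; apply/ffunP => j; rewrite !ffunE addKb.
rewrite {1}(reindex_inj (inv_inj flK)) /=.
by under eq_bigr do rewrite Gk; rewrite sumrN addNr.
Qed.

Lemma sum_sgn (R : realType) (N : nat) (k : 'I_N) :
  \sum_(s : {ffun 'I_N -> bool}) (sgn (s k) : R) = 0.
Proof. by apply: (sum_signs_odd (k := k)) => s; rewrite ffunE eqxx sgnN. Qed.

Lemma sum_sgn2 (R : realType) (N : nat) (k l : 'I_N) :
  \sum_(s : {ffun 'I_N -> bool}) (sgn (s k) * sgn (s l) : R)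
    = (k == l)%:R * 2 ^+ N.
Proof.
case: eqVneq => [<-|kl]; last first.
  rewrite mul0r; apply: (sum_signs_odd (k := k)) => s.
  by rewrite !ffunE eqxx (negbTE (_ : l != k)) 1?eq_sym// sgnN mulNr.
rewrite mul1r (eq_bigr (fun=> 1)) => [|s _]; last first.
  by rewrite -expr2 -real_normK ?num_real// normr_sgn expr1n.
by rewrite sumr_const card_ffun card_bool card_ord natrX.
Qed.

Lemma rademacher_sum_le (R : realType) (T : finType) (N : nat)
    (f : T -> R) (D : {ffun 'I_N -> T}) (s : {ffun 'I_N -> bool}) :
  (forall x, 0 <= f x <= 1) ->
  \sum_(j < N) sgn (s j) * f (D j) <= N%:R.
Proof.
move=> f01; rewrite -[N in leRHS]card_ord -sumr_const; apply: ler_sum => j _.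
rewrite (le_trans (ler_norm _))// normrM normr_sgn mul1r ger0_norm.
  by case/andP: (f01 (D j)).
by case/andP: (f01 (D j)).
Qed.

Lemma rademacher_sum_le_sup (R : realType) (T : finType) (I : Type) (N : nat)
    (g : I -> T -> R) (i : I) (D : {ffun 'I_N -> T})
    (s : {ffun 'I_N -> bool}) :
  (forall i x, 0 <= g i x <= 1) ->
  (\sum_(j < N) sgn (s j) * g i (D j)) / Num.sqrt N%:R <=
  sup (range (fun i : I =>
    (\sum_(j < N) sgn (s j) * g i (D j)) / Num.sqrt N%:R)).
Proof.
move=> g01.
apply: (@le_sup_range _ _ (fun i : I =>
  (\sum_(j < N) sgn (s j) * g i (D j)) / Num.sqrt N%:R)
  (N%:R / Num.sqrt N%:R)) => k.
by rewrite ler_wpM2r ?invr_ge0 ?sqrtr_ge0// rademacher_sum_le.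
Qed.

(** The supremum dominates the member [i0], whose signed sum averages to zero over the signs. *)
Lemma rademacher_ge0 (R : realType) (T : finType) (I : Type) (N : nat)
    (p : T -> R) (g : I -> T -> R) (i0 : I) :
  (forall x, 0 <= p x) -> (forall i x, 0 <= g i x <= 1) ->
  0 <= rademacher N p g.
Proof.
move=> p0 g01; apply: sumr_ge0 => D _; rewrite mulr_ge0 ?prodr_ge0//.
rewrite mulr_ge0 ?invr_ge0 ?exprn_ge0//.
have E0 : \sum_(s : {ffun 'I_N -> bool})
    (\sum_(j < N) sgn (s j) * g i0 (D j)) / Num.sqrt N%:R = 0.
  rewrite -mulr_suml exchange_big big1 ?mul0r//= => j _.
  by rewrite -mulr_suml sum_sgn mul0r.
rewrite -[leLHS]E0; apply: ler_sum => s _.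
exact: rademacher_sum_le_sup.
Qed.

(** Exchanging the two samples at the coordinates where [s] is false preserves the product
    weight. *)
Lemma iid_E_swap (R : realType) (T : finType) (N : nat) (p : T -> R)
    (H : {ffun 'I_N -> T} -> {ffun 'I_N -> T} -> R)
    (s : {ffun 'I_N -> bool}) :
  iid_E p (fun D => iid_E p (fun D' => H D D')) =
  iid_E p (fun D => iid_E p (fun D' =>
    H [ffun j => if s j then D j else D' j]
      [ffun j => if s j then D' j else D j])).
Proof.
rewrite /iid_E.
under eq_bigr do rewrite mulr_sumr.
under [RHS]eq_bigr do rewrite mulr_sumr.
rewrite !pair_big /=.
pose sw (DD : {ffun 'I_N -> T} * {ffun 'I_N -> T}) :=
  ([ffun j => if s j then DD.1 j else DD.2 j] : {ffun 'I_N -> T},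
   [ffun j => if s j then DD.2 j else DD.1 j] : {ffun 'I_N -> T}).
have swK : involutive sw.
  move=> [D D']; rewrite /sw /=.
  by congr pair; apply/ffunP => j; rewrite !ffunE; case: (s j).
rewrite (reindex_inj (inv_inj swK)) /=; apply: eq_bigr => -[D D'] _ /=.
rewrite !mulrA; congr (_ * _); rewrite -!big_split /=; apply: eq_bigr => j _.
by rewrite !ffunE; case: (s j) => //; rewrite mulrC.
Qed.

(** Ghost-sample argument: the risk is the mean empirical risk of an independent copy [D'], and
    random exchanges between [D] and [D'] introduce the signs. Each sample contributes one
    Rademacher average, whence the factor [2]. *)
Lemma symmetrization (R : realType) (T : finType) (I : Type) (N : nat)
    (p : T -> R) (g : I -> T -> R) (i0 : I) :
  (forall x, 0 <= p x) -> \sum_x p x = 1 -> (0 < N)%N ->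
  (forall i x, 0 <= g i x <= 1) ->
  iid_E p (fun D : {ffun 'I_N -> T} => sup (range (fun i : I =>
     \sum_x p x * g i x - N%:R^-1 * \sum_(j < N) g i (D j))))
    <= 2 * rademacher N p g / Num.sqrt N%:R.
Proof.
move=> p0 p1 N0 g01.
have Ngt0 : (0 : R) < N%:R by rewrite ltr0n.
pose H (D D' : {ffun 'I_N -> T}) := sup (range (fun i : I =>
  \sum_(j < N) (g i (D' j) - g i (D j)))).
have H_ge i (D D' : {ffun 'I_N -> T}) : \sum_(j < N) (g i (D' j) - g i (D j)) <= H D D'.
  apply: (le_sup_range (c := N%:R)) => k.
  rewrite -[N in leRHS]card_ord -sumr_const; apply: ler_sum => j _.
  have := g01 k (D j); have := g01 k (D' j); lra.
pose K (s : {ffun 'I_N -> bool}) (D : {ffun 'I_N -> T}) := sup (range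
  (fun i : I => (\sum_(j < N) sgn (s j) * g i (D j)) / Num.sqrt N%:R)).
have K_ge i (s : {ffun 'I_N -> bool}) (D : {ffun 'I_N -> T}) :
    \sum_(j < N) sgn (s j) * g i (D j) <= Num.sqrt N%:R * K s D.
  rewrite mulrC -ler_pdivrMr ?sqrtr_gt0//.
  exact: rademacher_sum_le_sup.
(* The two samples enter with opposite signs; negation preserves the uniform law on sign vectors. *)
pose neg (s : {ffun 'I_N -> bool}) : {ffun 'I_N -> bool} := [ffun j => ~~ s j].
have negK : involutive neg by move=> s; apply/ffunP => j; rewrite !ffunE negbK.
have H_le (s : {ffun 'I_N -> bool}) (D D' : {ffun 'I_N -> T}) :
    H [ffun j => if s j then D j else D' j]
    [ffun j => if s j then D' j else D j] <=
    Num.sqrt N%:R * (K s D' + K (neg s) D).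
  apply: sup_range_le => // i.
  have -> : \sum_(j < N) (g i ([ffun j => if s j then D' j else D j] j) -
      g i ([ffun j => if s j then D j else D' j] j)) =
      \sum_(j < N) sgn (s j) * g i (D' j) +
      \sum_(j < N) sgn (neg s j) * g i (D j).
    rewrite -big_split; apply: eq_bigr => j _; rewrite !ffunE sgnN /sgn.
    by case: (s j) => /=; ring.
  by rewrite mulrDr lerD.
(* The supremum of a mean over [D'] is at most the mean of the supremum. *)
apply: (@le_trans _ _ (iid_E p (fun D => iid_E p (fun D' => N%:R^-1 * H D D')))).
  apply: iid_E_le => // D; apply: sup_range_le => // i.
  rewrite -(iid_E_mean (g i) p1 N0).
  rewrite -[X in _ - X](iid_E_cst N _ p1) -mulN1r -iid_EZ -iid_ED.
  apply: iid_E_le => // D'.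
  rewrite mulN1r -mulrBr -sumrB ler_wpM2l ?invr_ge0 ?ler0n//.
(* The left side does not depend on [s], so the bound may be averaged over all sign vectors at the
   end. *)
have EH (s : {ffun 'I_N -> bool}) : iid_E p (fun D => iid_E p (fun D' => N%:R^-1 * H D D')) <=
    (Num.sqrt N%:R)^-1 * (iid_E p (K s) + iid_E p (K (neg s))).
  rewrite (iid_E_swap _ _ s).
  rewrite -{1}(iid_E_cst N (iid_E p (K s)) p1) -iid_ED -iid_EZ.
  apply: iid_E_le => // D.
  rewrite -(iid_E_cst N (K (neg s) D) p1) -iid_ED -iid_EZ.
  apply: iid_E_le => // D'.
  have -> : (Num.sqrt N%:R : R)^-1 = N%:R^-1 * Num.sqrt N%:R.
    have q0 : Num.sqrt N%:R != 0 :> R by rewrite sqrtr_eq0 -ltNge.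
    have {2}-> : (N%:R : R) = Num.sqrt N%:R ^+ 2 by rewrite sqr_sqrtr ?ler0n.
    by field.
  by rewrite -mulrA ler_wpM2l ?invr_ge0 ?ler0n.
have N2 : (0 : R) < 2 ^+ N by rewrite exprn_gt0.
rewrite -(ler_pM2l N2).
have -> : 2 ^+ N * (2 * rademacher N p g / Num.sqrt N%:R) =
    \sum_(s : {ffun 'I_N -> bool})
     (Num.sqrt N%:R)^-1 * (iid_E p (K s) + iid_E p (K (neg s))).
  rewrite -mulr_sumr big_split /=.
  have -> : \sum_s iid_E p (K (neg s)) = \sum_s iid_E p (K s).
    by rewrite [RHS](reindex_inj (inv_inj negK)).
  rewrite -iid_E_sum /rademacher iid_EZ.
  by field; rewrite ?sqrtr_eq0 -?ltNge ?Ngt0 ?expf_neq0// lt0r_neq0.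
have -> : 2 ^+ N * iid_E p (fun D => iid_E p (fun D' => N%:R^-1 * H D D'))
  = \sum_(s : {ffun 'I_N -> bool})
       iid_E p (fun D => iid_E p (fun D' => N%:R^-1 * H D D')).
  by rewrite sumr_const card_ffun card_bool card_ord -[RHS]mulr_natl natrX.
by apply: ler_sum => s _; exact: EH.
Qed.

(** * Positive semidefinite matrices *)

Lemma adjmM (R : realType) (m n k : nat) (A : 'M[R[i]]_(m, n))
    (B : 'M[R[i]]_(n, k)) : adjm (A *m B) = adjm B *m adjm A.
Proof. by rewrite /adjm trmx_mul map_mxM. Qed.

Lemma adjmK (R : realType) (m n : nat) (A : 'M[R[i]]_(m, n)) :
  adjm (adjm A) = A.
Proof. by apply/matrixP => i j; rewrite !mxE conjcK. Qed.

Lemma adjmD (R : realType) (m n : nat) (A B : 'M[R[i]]_(m, n)) :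
  adjm (A + B) = adjm A + adjm B.
Proof. by rewrite /adjm linearD map_mxD. Qed.

Lemma adjmB (R : realType) (m n : nat) (A B : 'M[R[i]]_(m, n)) :
  adjm (A - B) = adjm A - adjm B.
Proof. by rewrite /adjm linearB map_mxB. Qed.

Lemma adjm1 (R : realType) (n : nat) : adjm 1%:M = 1%:M :> 'M[R[i]]_n.
Proof. by rewrite /adjm trmx1 map_mx1. Qed.

Lemma adjmZ (R : realType) (m n : nat) (c : R) (A : 'M[R[i]]_(m, n)) :
  adjm (c%:C%C *: A) = c%:C%C *: adjm A.
Proof. by apply/matrixP => i j; rewrite !mxE rmorphM /= oppr0. Qed.

Lemma adjm_delta (R : realType) (n : nat) (i : 'I_n) :
  adjm (delta_mx i 0 : 'cV[R[i]]_n) = delta_mx 0 i.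
Proof.
rewrite /adjm trmx_delta; apply/matrixP => a b; rewrite !mxE.
by case: (_ && _); rewrite /= ?oppr0.
Qed.

Lemma psd_conj (R : realType) (m n : nat) (B : 'M[R[i]]_(n, m))
    (A : 'M[R[i]]_n) : psd A -> psd (adjm B *m A *m B).
Proof.
move=> [hA pA]; split; first by rewrite !adjmM adjmK hA mulmxA.
by move=> v; have := pA (B *m v); rewrite adjmM !mulmxA.
Qed.

Lemma psdD (R : realType) (n : nat) (A B : 'M[R[i]]_n) :
  psd A -> psd B -> psd (A + B).
Proof.
move=> [hA pA] [hB pB]; split; first by rewrite adjmD hA hB.
by move=> v; rewrite mulmxDr mulmxDl mxE addr_ge0.
Qed.

Lemma psd0 (R : realType) (n : nat) : psd (0 : 'M[R[i]]_n).
Proof.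
split; first by rewrite /adjm trmx0 map_mx0.
by move=> v; rewrite mulmx0 mul0mx mxE.
Qed.

Lemma psd_sum (R : realType) (n : nat) (J : finType)
    (A : J -> 'M[R[i]]_n) : (forall j, psd (A j)) -> psd (\sum_j A j).
Proof.
move=> pA; apply: (big_ind (@psd R n)) => [|B C|j _]; first exact: psd0.
  exact: psdD.
exact: pA.
Qed.

Lemma psdZ (R : realType) (n : nat) (c : R) (A : 'M[R[i]]_n) :
  0 <= c -> psd A -> psd (c%:C%C *: A).
Proof.
move=> c0 [hA pA]; split; first by rewrite adjmZ hA.
by move=> v; rewrite -scalemxAr -scalemxAl mxE mulr_ge0// lecR.
Qed.

Lemma mul_conj_ge0 (R : realType) (x : R[i]) : 0 <= conjc x * x.
Proof.
case: x => a b; rewrite lecE /=; apply/andP; split.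
  by apply/eqP; ring.
by rewrite mulNr opprK addr_ge0// -expr2 sqr_ge0.
Qed.

Lemma psd1 (R : realType) (n : nat) : psd (1%:M : 'M[R[i]]_n).
Proof.
split; first exact: adjm1.
move=> v; rewrite mulmx1 mxE; apply: sumr_ge0 => i _.
by rewrite !mxE mul_conj_ge0.
Qed.

Lemma psd_trace_ge0 (R : realType) (n : nat) (A : 'M[R[i]]_n) :
  psd A -> 0 <= \tr A.
Proof.
move=> [_ pA]; apply: sumr_ge0 => i _.
have := pA (delta_mx i 0); congr (0 <= _).
by rewrite adjm_delta -rowE -colE !mxE.
Qed.

(** * Spectral decomposition, square roots and inverses *)

Definition diagC {R : realType} {n : nat} (d : 'I_n -> R) : 'M[R[i]]_n :=
  diag_mx (\row_i (d i)%:C%C).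

Lemma diagC_psd (R : realType) (n : nat) (d : 'I_n -> R) :
  (forall i, 0 <= d i) -> psd (diagC d).
Proof.
move=> d0; split.
  apply/matrixP => i j; rewrite !mxE eq_sym.
  by case: eqVneq => [->|_]; rewrite ?mulr1n ?mulr0n /= oppr0.
move=> v; rewrite -mulmxA mxE; apply: sumr_ge0 => i _.
by rewrite mul_diag_mx !mxE mulrCA mulr_ge0 ?mul_conj_ge0// lecR.
Qed.

Lemma diagCM (R : realType) (n : nat) (d e : 'I_n -> R) :
  diagC d *m diagC e = diagC (fun i => d i * e i).
Proof.
rewrite /diagC mulmx_diag; congr diag_mx; apply/rowP => i.
by rewrite !mxE -rmorphM.
Qed.

(** The spectral theorem for normal matrices; the eigenvalues are values of the quadratic form of
    [A], hence real and nonnegative. *)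
Lemma psd_spectral (R : realType) (n : nat) (A : 'M[R[i]]_n) : psd A ->
  exists (P : 'M[R[i]]_n) (d : 'I_n -> R),
    [/\ P *m adjm P = 1%:M, forall i, 0 <= d i & A = adjm P *m diagC d *m P].
Proof.
move=> [hA pA].
(* Identifies the conjugate transpose of the library with [adjm]. *)
have conjE m k (B : 'M[R[i]]_(m, k)) : map_mx (@Num.conj R[i]) B^T = adjm B.
  by apply/matrixP => i j; rewrite !mxE.
have nA : A \is normalmx.
  by apply/normalmxP; rewrite conjE hA.
have /orthomx_spectralP := nA.
set P := spectralmx A; set d := spectral_diag A => AE.
have PU : P *m adjm P = 1%:M.
  by rewrite -conjE; apply/unitarymxP; exact: spectral_unitarymx.
have Pinv : invmx P = adjm P.
  by rewrite -conjE; exact: invmx_unitary (spectral_unitarymx A).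
rewrite Pinv in AE.
have dE : diag_mx d = P *m A *m adjm P.
  by rewrite AE !mulmxA PU mul1mx -mulmxA PU mulmx1.
have d0 i : 0 <= d 0 i.
  have := pA (adjm P *m delta_mx i 0); rewrite adjmM adjmK.
  rewrite adjm_delta !mulmxA -(mulmxA _ P A) -(mulmxA _ (P *m A)) -dE.
  by rewrite -rowE -colE !mxE eqxx mulr1n.
exists P, (fun i => complex.Re (d 0 i)); split; first exact: PU.
  by move=> i; have := d0 i; rewrite lecE => /andP[].
rewrite {1}AE; congr (_ *m diag_mx _ *m _); apply/rowP => i; rewrite !mxE.
have := d0 i; case: (d 0 i) => a b; rewrite lecE /=.
by move=> /andP[/eqP ->].
Qed.

Lemma psd_sqrt (R : realType) (n : nat) (A : 'M[R[i]]_n) : psd A ->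
  exists2 S : 'M[R[i]]_n, psd S & S *m S = A.
Proof.
move=> /psd_spectral[P [d [PU d0 ->]]].
exists (adjm P *m diagC (fun i => Num.sqrt (d i)) *m P).
  by apply: psd_conj; apply: diagC_psd => i; exact: sqrtr_ge0.
rewrite !mulmxA -(mulmxA _ P (adjm P)) PU mulmx1.
rewrite -(mulmxA (adjm P)) diagCM; congr (_ *m diagC _ *m _).
by apply/funext => i; rewrite -expr2 sqr_sqrtr.
Qed.

(** With [S] a positive root of [A], cyclicity turns the trace into that of [S B S]. *)
Lemma psd_trace_mul_ge0 (R : realType) (n : nat) (A B : 'M[R[i]]_n) :
  psd A -> psd B -> 0 <= \tr (A *m B).
Proof.
move=> /psd_sqrt[S pS <-] pB; rewrite -mulmxA mxtrace_mulC -{1}(proj1 pS).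
by apply: psd_trace_ge0; exact: psd_conj.
Qed.

(** The inverse is the conjugate of [B] by the Hermitian matrix [invmx B]. *)
Lemma invmx_psd (R : realType) (n : nat) (B : 'M[R[i]]_n) :
  B \in unitmx -> psd B -> psd (invmx B).
Proof.
move=> Bu pB.
have hV : adjm (invmx B) = invmx B.
  rewrite -[LHS]mulmx1 -(mulmxV Bu) mulmxA -{2}(proj1 pB) -adjmM mulmxV//.
  by rewrite adjm1 mul1mx.
by have := psd_conj (invmx B) pB; rewrite hV mulVmx// mul1mx.
Qed.

(** For [v] in the kernel, [v Q v^* + e |v|^2 = 0] with both terms nonnegative, which forces
    [v = 0]. *)
Lemma psdDscalar_unit (R : realType) (n : nat) (Q : 'M[R[i]]_n) (e : R) :
  psd Q -> 0 < e -> Q + e%:C%C *: 1%:M \in unitmx.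
Proof.
move=> pQ e0; rewrite -row_free_unit; apply: inj_row_free => v vB.
have vQv : 0 <= (v *m Q *m adjm v) 0 0.
  by have := proj2 pQ (adjm v); rewrite adjmK.
have vv : 0 <= (v *m adjm v) 0 0.
  by have := proj2 (psd1 R n) (adjm v); rewrite adjmK mulmx1.
have : (v *m (Q + e%:C%C *: 1%:M) *m adjm v) 0 0 = 0 by rewrite vB mul0mx mxE.
rewrite mulmxDr mulmxDl -scalemxAr mulmx1 -scalemxAl mxE [X in _ + X]mxE.
move/eqP; rewrite paddr_eq0//; last by rewrite mulr_ge0// lecR ltW.
move=> /andP[_]; rewrite mulf_eq0 => /orP[/eqP[]e00|].
  by rewrite e00 ltxx in e0.
rewrite mxE psumr_eq0 => [/allP v0|j _]; last first.
  by rewrite !mxE mulrC mul_conj_ge0.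
apply/rowP => j; rewrite mxE; have := v0 j (mem_index_enum j).
by rewrite !mxE mulf_eq0 conjc_eq0 orbb => /eqP.
Qed.

(** * Real parts of traces and trace inequalities *)

Definition retr {R : realType} {n : nat} (A : 'M[R[i]]_n) : R :=
  complex.Re (\tr A).

Lemma retrD (R : realType) (n : nat) (A B : 'M[R[i]]_n) :
  retr (A + B) = retr A + retr B.
Proof. by rewrite /retr !raddfD. Qed.

Lemma retrZ (R : realType) (n : nat) (c : R) (A : 'M[R[i]]_n) :
  retr (c%:C%C *: A) = c * retr A.
Proof.
by rewrite /retr mxtraceZ; case: (\tr A) => a b /=; rewrite mul0r subr0.
Qed.

Lemma retrN (R : realType) (n : nat) (A : 'M[R[i]]_n) : retr (- A) = - retr A.
Proof. by rewrite /retr !raddfN. Qed.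

Lemma retrB (R : realType) (n : nat) (A B : 'M[R[i]]_n) :
  retr (A - B) = retr A - retr B.
Proof. by rewrite retrD retrN. Qed.

Lemma retr_sum (R : realType) (n : nat) (J : finType) (A : J -> 'M[R[i]]_n) :
  retr (\sum_j A j) = \sum_j retr (A j).
Proof.
apply: (big_morph retr (@retrD R n)).
by rewrite /retr mxtrace0.
Qed.

Lemma retr1 (R : realType) (n : nat) : retr (1%:M : 'M[R[i]]_n) = n%:R.
Proof.
rewrite /retr mxtrace1; elim: n => // n IH.
by rewrite -[in RHS]natr1 -IH -natr1; case: (n%:R : R[i]) => a b.
Qed.

Lemma retr_mulC (R : realType) (n : nat) (A B : 'M[R[i]]_n) :
  retr (A *m B) = retr (B *m A).
Proof. by rewrite /retr mxtrace_mulC. Qed.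

Lemma retr_ge0 (R : realType) (n : nat) (A : 'M[R[i]]_n) :
  psd A -> 0 <= retr A.
Proof. by move/psd_trace_ge0; rewrite lecE => /andP[]. Qed.

Lemma retr_mul_ge0 (R : realType) (n : nat) (A B : 'M[R[i]]_n) :
  psd A -> psd B -> 0 <= retr (A *m B).
Proof.
by move=> pA pB; have := psd_trace_mul_ge0 pA pB; rewrite lecE => /andP[].
Qed.

(* With [X] one effect of the POVM, [1 - (2X - 1)^2 = 4 X (1 - X)], and the
   right-hand side is positive because [X] and [1 - X] commute. *)
Lemma povm_contraction (R : realType) (n : nat) (M : bool -> 'M[R[i]]_n)
    (B : 'M[R[i]]_n) (A := M false - M true) :
  povm M -> psd B -> retr (A *m B *m A) <= retr B.
Proof.
move=> [pX [pY XY]] pB; rewrite /A; clear A.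
move: (M false) (M true) pX pY XY => X Y pX pY XY.
have YE : Y = 1%:M - X by rewrite -XY addrC addKr.
have pC : psd (X *m Y *m X + Y *m X *m Y).
  apply: psdD; first by rewrite -{1}(proj1 pX); exact: psd_conj.
  by rewrite -{1}(proj1 pY); exact: psd_conj.
have AA : (X - Y) *m (X - Y) =
    1%:M - (4 : R)%:C%C *: (X *m Y *m X + Y *m X *m Y).
  rewrite YE !(mulmxBl, mulmxBr, mul1mx, mulmx1, mulmxA).
  move: (X *m X *m X) (X *m X) => Z W.
  by apply/matrixP => i j; rewrite !mxE; case: eqP => _ /=; ring.
rewrite -mulmxA retr_mulC -mulmxA AA mulmxBr mulmx1 retrB -scalemxAr retrZ.
by rewrite gerBl mulr_ge0// retr_mul_ge0.
Qed.

(* Expanding the positive matrix [(A - B^-1 S)^* B (A - B^-1 S)]. *)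
Lemma retr_mul_le (R : realType) (n : nat) (A B S : 'M[R[i]]_n) :
  adjm A = A -> adjm S = S -> psd B -> B \in unitmx ->
  2 * retr (A *m S) <= retr (A *m B *m A) + retr (invmx B *m (S *m S)).
Proof.
move=> hA hS pB Bu.
have := retr_ge0 (psd_conj (A - invmx B *m S) pB).
rewrite adjmB adjmM hA hS (proj1 (invmx_psd Bu pB)).
have -> : (A - S *m invmx B) *m B *m (A - invmx B *m S) =
    A *m B *m A - A *m S - S *m A + S *m invmx B *m S.
  rewrite !(mulmxBl, mulmxBr) !mulmxA.
  rewrite -!(mulmxA _ (invmx B) B) mulVmx// mulmx1.
  rewrite -!(mulmxA _ B (invmx B)) mulmxV// mulmx1.
  move: (A *m B *m A) (A *m S) (S *m A) (S *m invmx B *m S) => ? ? ? ?.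
  by apply/matrixP => i j; rewrite !mxE; ring.
rewrite retrD !retrB (retr_mulC S A) -(mulmxA S) (retr_mulC S) -!mulmxA.
lra.
Qed.

(** From [Q^2 = B Q - e Q] one gets [B^-1 Q^2 = Q - e B^-1 Q], and the subtracted term has
    nonnegative trace. *)
Lemma retr_invmx_sqr_le (R : realType) (n : nat) (Q : 'M[R[i]]_n) (e : R)
    (B := Q + e%:C%C *: 1%:M) :
  psd Q -> 0 < e -> retr (invmx B *m (Q *m Q)) <= retr Q.
Proof.
move=> pQ e0.
have Bu : B \in unitmx by exact: psdDscalar_unit.
have pB : psd B by apply: psdD => //; apply: psdZ (psd1 _ _); exact: ltW.
have QE : Q *m Q = B *m Q - e%:C%C *: Q.
  by rewrite /B mulmxDl -scalemxAl mul1mx addrK.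
rewrite QE mulmxBr mulKmx// -scalemxAr retrB retrZ gerBl.
by rewrite mulr_ge0 ?(ltW e0)// retr_mul_ge0//; exact: invmx_psd.
Qed.

Lemma density_retr (R : realType) (n : nat) (r : 'M[R[i]]_n) :
  density r -> retr r = 1.
Proof. by move=> [_ r1]; rewrite /retr r1. Qed.

(** The eigenvalues are nonnegative with sum [1], hence at most [1], so [r - r^2] is positive
    semidefinite. *)
Lemma density_sqr_le1 (R : realType) (n : nat) (r : 'M[R[i]]_n) :
  density r -> retr (r *m r) <= 1.
Proof.
move=> dr; rewrite -[leRHS](density_retr dr) -subr_ge0 -retrB.
have r1 := density_retr dr; case: dr => pr _.
have [P [d [PU d0 rE]]] := psd_spectral pr.
have d_le1 i : d i <= 1.
  have <- : \sum_i d i = 1.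
    rewrite -r1 rE -mulmxA retr_mulC -mulmxA PU mulmx1 /retr raddf_sum.
    by apply: eq_bigr => j _; rewrite !mxE eqxx mulr1n.
  by rewrite (bigD1 i)//= lerDl sumr_ge0.
have -> : r - r *m r = adjm P *m diagC (fun i => d i - d i * d i) *m P.
  rewrite rE !mulmxA -(mulmxA _ P (adjm P)) PU mulmx1.
  rewrite -(mulmxA (adjm P) _ (diagC d)) diagCM -mulmxBl -mulmxBr.
  congr (_ *m _ *m _); rewrite -raddfB; congr diag_mx.
  by apply/rowP => i; rewrite !mxE rmorphB.
apply: retr_ge0; apply: psd_conj; apply: diagC_psd => i.
by rewrite subr_ge0 ler_piMr.
Qed.

(** The trace of [(Q - 1)^2] is nonnegative. This later bounds the trace of a root by the
    dimension. *)
Lemma retr_le_retr_sqr (R : realType) (n : nat) (Q : 'M[R[i]]_n) :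
  psd Q -> 2 * retr Q <= retr (Q *m Q) + n%:R.
Proof.
move=> pQ.
have := retr_ge0 (psd_conj (Q - 1%:M) (psd1 R n)).
rewrite mulmx1 adjmB adjm1 (proj1 pQ).
rewrite !(mulmxBl, mulmxBr, mul1mx, mulmx1) !retrB retr1; lra.
Qed.

(** * Losses of binary measurements *)

Lemma povm_retr (R : realType) (n : nat) (M : bool -> 'M[R[i]]_n)
    (r : 'M[R[i]]_n) : povm M -> density r ->
  retr (M false *m r) + retr (M true *m r) = 1.
Proof.
by move=> [_ [_ M1]] dr; rewrite -retrD -mulmxDl M1 mul1mx density_retr.
Qed.

Lemma loss01 (R : realType) (n : nat) (X : Type) (rho : X -> 'M[R[i]]_n)
    (M : bool -> 'M[R[i]]_n) (c : bool) (x : X) :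
  povm M -> density (rho x) -> 0 <= loss rho M c x <= 1.
Proof.
move=> pM dr; have := povm_retr pM dr.
have := retr_mul_ge0 (proj1 pM) (proj1 dr).
have := retr_mul_ge0 (proj1 (proj2 pM)) (proj1 dr).
by rewrite /loss -/(retr _); case: c; lra.
Qed.

(** Each effect is [(1 +/- A) / 2] with [A = M_0 - M_1], so the label enters only as a sign. *)
Lemma loss_observable (R : realType) (n : nat) (X : Type)
    (rho : X -> 'M[R[i]]_n) (M : bool -> 'M[R[i]]_n) (c : bool) (x : X) :
  povm M -> density (rho x) ->
  loss rho M c x =
    2^-1 - 2^-1 * sgn (~~ c) * retr ((M false - M true) *m rho x).
Proof.
move=> pM dr; have := povm_retr pM dr.
rewrite mulmxBl retrB /loss -/(retr _) /sgn; case: c => /=; lra.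
Qed.

(** Shows that the suprema and infima over measurements range over nonempty sets. *)
Lemma povm_trivial (R : realType) (n : nat) :
  povm (fun b : bool => if b then 0 else 1%:M : 'M[R[i]]_n).
Proof. by split; [exact: psd1|split; [exact: psd0|rewrite addr0]]. Qed.

(** * Rademacher complexity of the measurements at a fixed parameter *)

Lemma rad_EE (R : realType) (X : finType) (I : Type) (N : nat)
    (p : bool * X -> R) (g : I -> bool * X -> R) :
  rad_E N p (fun D s => sup (range (fun i : I =>
    (\sum_(j < N) sgn (s j) * g i (D j)) / Num.sqrt N%:R))) =
  rademacher N p g.
Proof.
rewrite /rad_E /rademacher /iid_E /ds_prob; apply: eq_bigr => D _.
by rewrite mulr_sumr mulr_sumr; apply: eq_bigr => s _; rewrite mulrA.
Qed.

(** Existence of a positive root rules out the default value of [xget]. *)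
Lemma tr_msqrtP (R : realType) (n : nat) (A : 'M[R[i]]_n) : psd A ->
  exists Q : 'M[R[i]]_n, [/\ psd Q, Q *m Q = A & tr_msqrt A = retr Q].
Proof.
move=> /psd_sqrt[S pS SA]; rewrite /tr_msqrt.
case: xgetP => [Q _ [pQ QA]|/(_ S)]; first by exists Q.
by move=> /not_andP[].
Qed.

(** The matrix under the root in [renyi2_MI]. *)
Definition avg_sqr {R : realType} {n : nat} {X : finType} (p : bool * X -> R)
  (rho : X -> 'M[R[i]]_n) : 'M[R[i]]_n :=
  \sum_(x : X) Complex (marg p x) 0 *: (rho x *m rho x).

Lemma avg_sqrE (R : realType) (n : nat) (X : finType) (p : bool * X -> R)
    (rho : X -> 'M[R[i]]_n) :
  avg_sqr p rho = \sum_(cx : bool * X) (p cx)%:C%C *: (rho cx.2 *m rho cx.2).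
Proof.
rewrite (eq_bigr (fun cx => (p (cx.1, cx.2))%:C%C *: (rho cx.2 *m rho cx.2)));
  last by case.
rewrite -(pair_bigA _ (fun c x => (p (c, x))%:C%C *: (rho x *m rho x))) /=.
rewrite big_bool /= -big_split; apply: eq_bigr => x _ /=.
by rewrite -scalerDl addrC -rmorphD.
Qed.

Lemma psd_sqr (R : realType) (n : nat) (A : 'M[R[i]]_n) :
  psd A -> psd (A *m A).
Proof.
by move=> pA; have := psd_conj A (psd1 R n); rewrite mulmx1 (proj1 pA).
Qed.

Lemma avg_sqr_psd (R : realType) (n : nat) (X : finType) (p : bool * X -> R)
    (rho : X -> 'M[R[i]]_n) :
  (forall x, density (rho x)) -> (forall cx, 0 <= p cx) ->
  psd (avg_sqr p rho).
Proof.
move=> dr p0; rewrite avg_sqrE; apply: psd_sum => cx.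
by apply: psdZ => //; apply: psd_sqr; case: (dr cx.2).
Qed.

Lemma avg_sqr_le1 (R : realType) (n : nat) (X : finType) (p : bool * X -> R)
    (rho : X -> 'M[R[i]]_n) :
  (forall x, density (rho x)) -> (forall cx, 0 <= p cx) ->
  \sum_cx p cx = 1 -> retr (avg_sqr p rho) <= 1.
Proof.
move=> dr p0 p1; rewrite avg_sqrE retr_sum -p1; apply: ler_sum => cx _.
by rewrite retrZ ler_piMr// density_sqr_le1.
Qed.

(* The random matrix [S = N^-1/2 \sum_j (+/-) rho_j] has mean square
   [avg_sqr p rho = Q^2], so the bound of [retr_mul_le] averages to
   [(tr B + tr (B^-1 Q^2)) / 2]; then [B = Q + e] with [e -> 0]. *)
Lemma rademacher_povm_le (R : realType) (n : nat) (X : finType) (N : nat)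
    (p : bool * X -> R) (rho : X -> 'M[R[i]]_n) :
  (forall x, density (rho x)) -> (forall cx, 0 <= p cx) ->
  \sum_cx p cx = 1 -> (0 < N)%N ->
  rademacher N p (fun (M : {M : bool -> 'M[R[i]]_n | povm M}) cx =>
    loss rho (sval M) cx.1 cx.2) <= 2^-1 * tr_msqrt (avg_sqr p rho).
Proof.
move=> dr p0 p1 N0.
have [Q [pQ QQ ->]] := tr_msqrtP (avg_sqr_psd dr p0).
apply/ler_addgt0Pr => d d0.
(* Then [tr B] exceeds [tr Q] by [e n <= d]; the successor keeps the denominator nonzero when
   [n = 0]. *)
pose e := d / n.+1%:R.
have e0 : 0 < e by rewrite divr_gt0.
pose B := Q + e%:C%C *: 1%:M.
have Bu : B \in unitmx by exact: psdDscalar_unit.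
have pB : psd B by apply: psdD => //; apply: psdZ (psd1 _ _); exact: ltW.
have q0 : Num.sqrt N%:R != 0 :> R by rewrite sqrtr_eq0 -ltNge ltr0n.
pose w (cx : bool * X) : R := sgn (~~ cx.1).
pose h (a b : bool * X) : R :=
  w a * w b * retr (invmx B *m (rho a.2 *m rho b.2)).
(* A bound free of the measurement: the first term comes from the constant [1/2] in the loss, and
   the double sum expands [tr (B^-1 S^2)]. *)
pose bnd (D : {ffun 'I_N -> bool * X}) (s : {ffun 'I_N -> bool}) : R :=
  2^-1 * (\sum_(j < N) sgn (s j)) / Num.sqrt N%:R +
  4^-1 * (retr B + N%:R^-1 *
    \sum_(j < N) \sum_(k < N) sgn (s j) * sgn (s k) * h (D j) (D k)).
have le_bnd (D : {ffun 'I_N -> bool * X}) (s : {ffun 'I_N -> bool})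
     (M : {M : bool -> 'M[R[i]]_n | povm M}) :
   (\sum_(j < N) sgn (s j) * loss rho (sval M) (D j).1 (D j).2) / Num.sqrt N%:R
     <= bnd D s.
  case: M => M pM /=.
  pose A := M false - M true.
  (* The minus sign is that of the observable in [loss_observable]. *)
  pose S : 'M[R[i]]_n := \sum_(j < N)
    (- (sgn (s j) * w (D j) / Num.sqrt N%:R))%:C%C *: rho (D j).2.
  have hA : adjm A = A.
    by case: pM => [[hX _] [[hY _] _]]; rewrite /A adjmB hX hY.
  have hS : adjm S = S.
    rewrite /S; apply: (big_ind (fun Z => adjm Z = Z)).
    - by case: (psd0 R n).
    - by move=> Y Z hY hZ; rewrite adjmD hY hZ.
    - by move=> j _; rewrite adjmZ; case: (dr (D j).2) => -[-> _].
  have -> : (\sum_(j < N) sgn (s j) * loss rho M (D j).1 (D j).2) / Num.sqrt N%:R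
      = 2^-1 * (\sum_(j < N) sgn (s j)) / Num.sqrt N%:R + 2^-1 * retr (A *m S).
    rewrite /S mulmx_sumr retr_sum !mulr_sumr !mulr_suml -big_split.
    apply: eq_bigr => j _ /=; rewrite loss_observable// -scalemxAr retrZ -/A /w.
    by field.
  rewrite lerD2l.
  have -> : N%:R^-1 * \sum_(j < N) \sum_(k < N)
      sgn (s j) * sgn (s k) * h (D j) (D k) = retr (invmx B *m (S *m S)).
    rewrite /S mulmx_suml mulmx_sumr retr_sum mulr_sumr; apply: eq_bigr => j _.
    rewrite mulmx_sumr mulmx_sumr retr_sum mulr_sumr; apply: eq_bigr => k _.
    rewrite -!scalemxAl -!scalemxAr !retrZ /h.
    have {1}-> : (N%:R : R) = Num.sqrt N%:R ^+ 2 by rewrite sqr_sqrtr ?ler0n.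
    by field.
  have := retr_mul_le hA hS pB Bu; have := povm_contraction pM pB.
  rewrite -/A; lra.
have Ebnd : iid_E p (fun D : {ffun 'I_N -> bool * X} =>
    2 ^- N * \sum_s bnd D s) =
    4^-1 * (retr B + retr (invmx B *m (Q *m Q))).
  have N2 : (2 ^+ N : R) != 0 by rewrite expf_neq0.
  (* Averaging over the signs kills the linear term and, by orthogonality of distinct signs, all
     pairs with [j != k]. *)
  have bndE (D : {ffun 'I_N -> bool * X}) : 2 ^- N * \sum_s bnd D s =
      4^-1 * retr B + 4^-1 * (N%:R^-1 * \sum_(j < N) h (D j) (D j)).
    rewrite /bnd big_split /= -mulr_suml -mulr_sumr exchange_big /=.
    rewrite [X in _ * X / _]big1 => [|j _]; last exact: sum_sgn.
    rewrite mulr0 mul0r add0r -mulr_sumr big_split /= sumr_const card_ffun.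
    rewrite card_bool card_ord -mulr_sumr exchange_big /=.
    have -> : \sum_(j < N) \sum_(s : {ffun 'I_N -> bool}) \sum_(k < N)
        sgn (s j) * sgn (s k) * h (D j) (D k) =
        2 ^+ N * \sum_(j < N) h (D j) (D j).
      rewrite mulr_sumr; apply: eq_bigr => j _; rewrite exchange_big /=.
      under eq_bigr do rewrite -mulr_suml sum_sgn2.
      rewrite (bigD1 j)//= eqxx mul1r big1 ?addr0// => k.
      by rewrite eq_sym => /negbTE ->; rewrite !mul0r.
    rewrite -[retr B *+ _]mulr_natl natrX; field.
    by rewrite N2 pnatr_eq0 -lt0n N0.
  transitivity (iid_E p (fun D : {ffun 'I_N -> bool * X} =>
      4^-1 * retr B + 4^-1 * (N%:R^-1 * \sum_(j < N) h (D j) (D j)))).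
    by congr iid_E; apply/funext.
  rewrite iid_ED iid_E_cst// iid_EZ (iid_E_mean (fun a => h a a))// mulrDr.
  (* On the diagonal the label signs square to [1], and the mean of [rho^2] is [Q^2]. *)
  congr (_ + _ * _); rewrite QQ avg_sqrE mulmx_sumr retr_sum.
  apply: eq_bigr => cx _; rewrite -scalemxAr retrZ /h; congr (_ * _).
  by rewrite /w /sgn; case: cx.1 => /=; rewrite ?mulrNN !mul1r.
apply: (@le_trans _ _ (iid_E p (fun D : {ffun 'I_N -> bool * X} =>
    2 ^- N * \sum_s bnd D s))).
  apply: iid_E_le => // D; rewrite ler_wpM2l ?invr_ge0 ?exprn_ge0//.
  apply: ler_sum => s _; apply: sup_range_le => [|M]; last exact: le_bnd.
  exact: (exist _ _ (povm_trivial R n)).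
rewrite Ebnd; have := retr_invmx_sqr_le pQ e0; rewrite -/B.
have -> : retr B = retr Q + e * n%:R by rewrite /B retrD retrZ retr1.
have : e * n%:R <= d.
  by rewrite /e mulrAC ler_pdivrMr ?ltr0n// ler_wpM2l ?(ltW d0)// ler_nat.
lra.
Qed.

(** * Excess risk of empirical risk minimizers *)

Definition risk {R : realType} {T : finType} (p f : T -> R) : R :=
  \sum_x p x * f x.

Definition emp {R : realType} {T : finType} {N : nat} (f : T -> R)
  (D : {ffun 'I_N -> T}) : R := N%:R^-1 * \sum_(j < N) f (D j).

Lemma emp_bounded_diff (R : realType) (T : finType) (N : nat) (f : T -> R) :
  (forall x, 0 <= f x <= 1) ->
  bounded_diff N%:R^-1 (emp f : {ffun 'I_N -> T} -> R).
Proof.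
move=> f01 D D' k DD'; rewrite /emp -[X in _ + X]mulr1 -mulrDr.
rewrite ler_wpM2l ?invr_ge0 ?ler0n// (bigD1 k)//= [in leRHS](bigD1 k)//=.
rewrite (eq_bigr (fun j => f (D' j))) => [|j jk]; last by rewrite DD'.
by rewrite addrAC lerD2r; have := f01 (D k); have := f01 (D' k); lra.
Qed.

Lemma le_sup_deviation (R : realType) (T : finType) (I : Type) (N : nat)
    (p : T -> R) (g : I -> T -> R) (D : {ffun 'I_N -> T}) (i : I) :
  (forall x, 0 <= p x) -> \sum_x p x = 1 ->
  (forall i x, 0 <= g i x <= 1) ->
  risk p (g i) - emp (g i) D <=
    sup (range (fun i : I => risk p (g i) - emp (g i) D)).
Proof.
move=> p0 p1 g01.
apply: (@le_sup_range _ _ (fun i => risk p (g i) - emp (g i) D) 1) => j.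
have : 0 <= emp (g j) D.
  rewrite mulr_ge0 ?invr_ge0 ?ler0n// sumr_ge0// => l _.
  by case/andP: (g01 j (D l)).
have : risk p (g j) <= 1.
  rewrite -p1; apply: ler_sum => x _; rewrite ler_piMr//.
  by case/andP: (g01 j x).
lra.
Qed.

Lemma sup_deviation_bounded_diff (R : realType) (T : finType) (I : Type)
    (i0 : I) (N : nat) (p : T -> R) (g : I -> T -> R) :
  (forall x, 0 <= p x) -> \sum_x p x = 1 ->
  (forall i x, 0 <= g i x <= 1) ->
  bounded_diff N%:R^-1 (fun D : {ffun 'I_N -> T} =>
    sup (range (fun i : I => risk p (g i) - emp (g i) D))).
Proof.
move=> p0 p1 g01 D D' k DD'; apply: (sup_range_le i0) => i.
have := le_sup_deviation D' i p0 p1 g01.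
have := @emp_bounded_diff R T N (g i) (g01 i) D' D k.
have D'D j : j != k -> D' j = D j by move=> /DD'.
move=> /(_ D'D); lra.
Qed.

(* The empirical risk of the minimizer is itself a function with bounded
   differences whose mean is below every risk, so that it plays the role of the
   comparator and no uniform bound over the minimizing parameter is needed. *)
Lemma erm_excess_risk (R : realType) (T : finType) (I : Type) (N : nat)
    (p : T -> R) (g : I -> T -> R) (ihat : {ffun 'I_N -> T} -> I)
    (opt : {ffun 'I_N -> T} -> R) (delta : R) :
  (forall x, 0 <= p x) -> \sum_x p x = 1 -> (0 < N)%N ->
  (forall i x, 0 <= g i x <= 1) ->
  (forall D i, emp (g (ihat D)) D <= emp (g i) D) ->
  (forall D c, (forall i, c <= risk p (g i)) -> c <= opt D) ->
  0 < delta < 1 ->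
  1 - delta <= \sum_(D : {ffun 'I_N -> T} |
      risk p (g (ihat D)) - opt D
        <= 2 * rademacher N p g / Num.sqrt N%:R
           + Num.sqrt (2 / N%:R * ln (2 / delta))) \prod_(j < N) p (D j).
Proof.
move=> p0 p1 N0 g01 erm optP /andP[d0 d1].
have [x0] := inhabited_sum1 p1.
pose i0 := ihat [ffun=> x0].
have Ngt0 : (0 : R) < N%:R by rewrite ltr0n.
pose Phi (D : {ffun 'I_N -> T}) :=
  sup (range (fun i : I => risk p (g i) - emp (g i) D)).
pose e (D : {ffun 'I_N -> T}) := emp (g (ihat D)) D.
pose F D := Phi D + e D.
(* Each summand contributes [1 / N]. For [e], the minimizer for [D'] serves as a competitor on
   [D]. *)
have Fc : bounded_diff (2 / N%:R) F.
  move=> D D' k DD'.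
  have := @sup_deviation_bounded_diff R T I i0 N p g p0 p1 g01 D D' k DD'.
  have := @emp_bounded_diff R T N (g (ihat D')) (g01 _) D D' k DD'.
  have := erm D (ihat D'); rewrite /F /Phi /e; lra.
(* With differences [2 / N] the McDiarmid exponent is [N t^2 / 2], which this [t] makes equal to
   [ln (2 / delta)]. *)
pose t := Num.sqrt (2 / N%:R * ln (2 / delta)).
have ln_ge0 : 0 <= ln (2 / delta) by rewrite ln_ge0// ler_pdivlMr//; lra.
have := mcdiarmid p0 p1 _ (sqrtr_ge0 _ : 0 <= t) N0 Fc.
rewrite divr_gt0// => /(_ isT).
have -> : - (2 * t ^+ 2 / (N%:R * (2 / N%:R) ^+ 2)) = - ln (2 / delta).
  rewrite sqr_sqrtr; last by rewrite mulr_ge0// divr_ge0// ltW.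
  by field; rewrite gt_eqF.
rewrite expRN lnK ?posrE ?divr_gt0// invf_div => tail.
apply: (@le_trans _ _ (1 - delta / 2)); first lra.
apply: le_trans tail _; rewrite [leLHS]big_mkcond [leRHS]big_mkcond /=.
apply: ler_sum => D _; case: ifPn => FD; last first.
  by case: ifP => // _; apply: prodr_ge0.
suff -> : risk p (g (ihat D)) - opt D <=
    2 * rademacher N p g / Num.sqrt N%:R + t by [].
have EPhi : iid_E p Phi <= 2 * rademacher N p g / Num.sqrt N%:R.
  exact: symmetrization i0 p0 p1 N0 g01.
(* For each fixed [i], the mean of the minimal empirical risk is at most the mean empirical risk of
   [i], which is its risk. *)
have Ee : iid_E p e <= opt D.
  apply: optP => i; rewrite /risk -(iid_E_mean (g i) p1 N0).
  by apply: iid_E_le => // D'; exact: erm.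
have EF : iid_E p F = iid_E p Phi + iid_E p e by rewrite -iid_ED.
have := le_sup_deviation D (ihat D) p0 p1 g01.
move: FD; rewrite EF /F /e /Phi; lra.
Qed.

(* At [t = 0] the junk value [ln 0 = 0] makes the exponential equal to [1]. *)
Lemma powR2_renyi2 (R : realType) (n : nat) (X : finType) (p : bool * X -> R)
    (rho : X -> 'M[R[i]]_n) (t := tr_msqrt (avg_sqr p rho)) :
  0 <= t -> t ^+ 2 <= powR 2 (renyi2_MI p rho) <= 1 + t ^+ 2.
Proof.
move=> t0; rewrite /renyi2_MI -/(avg_sqr p rho) -/t /powR gt_eqF//.
have l2 : ln 2 != 0 :> R by rewrite gt_eqF// ln_gt0// ltr1n.
have -> : 2 * (ln t / ln 2) * ln 2 = ln t *+ 2 by field.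
move: t0; rewrite le_eqVlt => /predU1P[<-|t0].
  by rewrite ln0// mul0rn expR0 expr0n addr0 lexx ler01.
by rewrite mulr2n expRD lnK ?posrE// -expr2 lexx lerDr ler01.
Qed.

(** Since [2 tr Q <= tr Q^2 + n <= 1 + n], the trace is bounded uniformly in the states. Suprema
    over parameters are thereby finite. *)
Lemma tr_msqrt_avg_sqr_bounds (R : realType) (n : nat) (X : finType)
    (p : bool * X -> R) (rho : X -> 'M[R[i]]_n) :
  (forall x, density (rho x)) -> (forall cx, 0 <= p cx) ->
  \sum_cx p cx = 1 ->
  0 <= tr_msqrt (avg_sqr p rho) <= n.+1%:R.
Proof.
move=> dr p0 p1; have [Q [pQ QQ ->]] := tr_msqrtP (avg_sqr_psd dr p0).
rewrite retr_ge0//=; have := retr_le_retr_sqr pQ; rewrite QQ.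
have := avg_sqr_le1 dr p0 p1; rewrite -natr1; have := ler0n R n; lra.
Qed.

(** * The two complexities as instances of [rademacher], and the final bounds *)

Lemma rad_M_E (R : realType) (n : nat) (X : finType) (Theta : Type) (N : nat)
    (p : bool * X -> R) (rho : Theta -> X -> 'M[R[i]]_n) :
  rad_M N p rho = sup (range (fun th : Theta =>
    rademacher N p (fun (M : {M : bool -> 'M[R[i]]_n | povm M}) cx =>
      loss (rho th) (sval M) cx.1 cx.2))).
Proof.
rewrite /rad_M.
have radE th : rad_E N p (fun D s => sup [set v : R | exists M, povm M /\
      v = rad_sum (rho th) M D s]) =
    rademacher N p (fun (M : {M : bool -> 'M[R[i]]_n | povm M}) cx =>
      loss (rho th) (sval M) cx.1 cx.2).
  rewrite -rad_EE; congr rad_E; apply/funext => D; apply/funext => s.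
  congr sup; apply/seteqP; split=> [v [M [pM ->]]|v [[M pM] _ <-]].
    by exists (exist _ M pM).
  by exists M.
congr sup; apply/seteqP; split=> [r [th ->]|r [th _ <-]]; exists th => //.
Qed.

Lemma rad_ThM_E (R : realType) (n : nat) (X : finType) (Theta : Type)
    (N : nat) (p : bool * X -> R) (rho : Theta -> X -> 'M[R[i]]_n) :
  rad_ThM N p rho = rademacher N p
    (fun (i : Theta * {M : bool -> 'M[R[i]]_n | povm M}) cx =>
      loss (rho i.1) (sval i.2) cx.1 cx.2).
Proof.
rewrite /rad_ThM -rad_EE; congr rad_E.
apply/funext => D; apply/funext => s; congr sup.
apply/seteqP; split=> [v [th [M [pM ->]]]|v [[th [M pM]] _ <-]].
  by exists (th, exist _ M pM).
by exists th, M.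
Qed.

Unset Implicit Arguments.

Theorem theorem4p2 (R : realType) (n : nat) (X : finType) (Theta : Type)
  (rho : Theta -> X -> 'M[R[i]]_n) (p : bool * X -> R) (N : nat)
  (Mhat : Theta -> dataset X N -> bool -> 'M[R[i]]_n)
  (thetahat : dataset X N -> Theta) (delta : R) :
  (forall th x, density (rho th x)) ->
  (forall cx, 0 <= p cx) -> \sum_(cx : bool * X) p cx = 1 ->
  (0 < N)%N ->
  (forall th D, povm (Mhat th D) /\
     forall M, povm M -> emp_risk (rho th) (Mhat th D) D <= emp_risk (rho th) M D) ->
  (forall D th M, povm M ->
     emp_risk (rho (thetahat D)) (Mhat (thetahat D) D) D <= emp_risk (rho th) M D) ->
  0 < delta < 1 ->
  1 - delta <= ds_Pr N p (fun D =>
     exp_risk p (rho (thetahat D)) (Mhat (thetahat D) D) - opt_risk p (rho (thetahat D))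
     <= 2 * (rad_ThM N p rho + rad_M N p rho) / Num.sqrt (N%:R)
        + Num.sqrt (2 / N%:R * ln (2 / delta)))
  /\ rad_M N p rho <= 2^-1 * Num.sqrt (sup [set v : R | exists th : Theta,
                                           v = powR 2 (renyi2_MI p (rho th))]).
Proof.
move=> dr p0 p1 N0 MhatP thP d01.
have [x0] := inhabited_sum1 p1.
(* The learning rule, evaluated at a constant data set, shows that [Theta] is inhabited. *)
have th0 : Theta := thetahat [ffun=> x0].
pose rad th := rademacher N p
  (fun (M : {M : bool -> 'M[R[i]]_n | povm M}) cx =>
    loss (rho th) (sval M) cx.1 cx.2).
pose t th := tr_msqrt (avg_sqr p (rho th)).
have t_bnd th : 0 <= t th <= n.+1%:R by exact: tr_msqrt_avg_sqr_bounds.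
have rad_le th : rad th <= 2^-1 * t th by exact: rademacher_povm_le.
have M0 : {M : bool -> 'M[R[i]]_n | povm M} := exist _ _ (povm_trivial R n).
have rad_ge0 th : 0 <= rad th.
  by apply: rademacher_ge0 => // -[M pM] cx; exact: loss01.
split; last first.
  rewrite rad_M_E -/rad; apply: (sup_range_le th0) => th.
  apply: le_trans (rad_le th) _; rewrite ler_pM2l ?invr_gt0//.
  have /andP[t0 _] := t_bnd th.
  rewrite -(ger0_norm t0) -sqrtr_sqr ler_wsqrtr//.
  have /andP[le_pow _] := @powR2_renyi2 R n X p (rho th) t0.
  apply: le_trans le_pow _; apply: ub_le_sup; last by exists th.
  (* The summand [1] covers a vanishing trace, where the convention for [ln 0] gives the power the
     value [1]. *)
  exists (1 + n.+1%:R ^+ 2) => _ [th' ->].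
  have /andP[t0' tn'] := t_bnd th'.
  have /andP[_ pow_le] := @powR2_renyi2 R n X p (rho th') t0'.
  by apply: le_trans pow_le _; rewrite lerD2l lerXn2r// nnegrE ?ler0n.
pose g (i : Theta * {M : bool -> 'M[R[i]]_n | povm M}) (cx : bool * X) : R :=
  loss (rho i.1) (sval i.2) cx.1 cx.2.
have g01 i cx : 0 <= g i cx <= 1 by apply: loss01 => //; exact: (svalP i.2).
(* Parameter and measurement are learned jointly, as one empirical minimizer over pairs. *)
pose ihat (D : {ffun 'I_N -> bool * X}) :
    Theta * {M : bool -> 'M[R[i]]_n | povm M} :=
  (thetahat D, exist _ _ (proj1 (MhatP (thetahat D) D))).
have := @erm_excess_risk R _ _ N p g ihat
  (fun D => opt_risk p (rho (thetahat D))) delta p0 p1 N0 g01.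
have erm D i : emp (g (ihat D)) D <= emp (g i) D.
  exact: thP (svalP i.2).
(* The optimal risk is an infimum over the pairs with parameter [thetahat D], so it dominates every
   lower bound over all pairs. *)
have opt D c : (forall i, c <= risk p (g i)) ->
    c <= opt_risk p (rho (thetahat D)).
  move=> c_le; apply: lb_le_inf.
    by exists (exp_risk p (rho (thetahat D)) (sval M0)), (sval M0); split => //;
      exact: svalP.
  by move=> _ [M [pM ->]]; exact: (c_le (thetahat D, exist _ M pM)).
move=> /(_ erm opt d01) /le_trans; apply.
rewrite /ds_Pr [leLHS]big_mkcond [leRHS]big_mkcond /=.
apply: ler_sum => D _; case: ifPn => FD; last first.
  by case: ifP => // _; apply: prodr_ge0.
rewrite ifT//; apply: le_trans FD _; rewrite lerD2r.
(* The passage to the stated right-hand side adds [rad_M N p rho], which is nonnegative because it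
   dominates the complexity at [th0]. *)
rewrite ler_wpM2r ?invr_ge0 ?sqrtr_ge0// ler_wpM2l// rad_ThM_E lerDl.
rewrite rad_M_E; apply: le_trans (rad_ge0 th0) _.
apply: (@le_sup_range _ _ rad (2^-1 * n.+1%:R)) => th.
apply: le_trans (rad_le th) _; rewrite ler_pM2l ?invr_gt0//.
by have /andP[] := t_bnd th.
Qed.
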